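(* For every self-similar group $(G,X)$, the commutator subgroup $\mathcal{V}_G'=[\mathcal{V}_G,\mathcal{V}_G]$ of $\mathcal{V}_G$ is simple.
   Context: Let $X$ be a finite set with $|X|\ge2$, $X^*$ the rooted tree of finite words (each $v$ joined to $vx$), $X^\omega$ the space of right-infinite sequences with the product topology. A complete antichain is a finite set $A\subset X^*$ of words, none a prefix of another, with $X^\omega=\bigsqcup_{v\in A}vX^\omega$. A self-similar group $(G,X)$ is a group $G$ acting faithfully by automorphisms of $X^*$ such that for every $g\in G$, $x\in X$ there exist $h\in G$, $y\in X$ with $g(xw)=yh(w)$ for all $w$. $\mathcal{V}_G$ is the group of all homeomorphisms $g$ of $X^\omega$ for which there exist complete antichains $A_1,A_2$, a bijection $\alpha:A_1\to A_2$ and $g_v\in G$ ($v\in A_1$) with $g(vw)=\alpha(v)g_v(w)$ for all $v\in A_1$, $w\in X^\omega$. *)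

(* Defs.v *)
From mathcomp Require Import all_boot.
Set Implicit Arguments. Unset Strict Implicit. Unset Printing Implicit Defensive.

Section SelfSimilar.
Variable X : finType.

Definition word := seq X.
Definition iword := nat -> X.

Definition tree_aut (t : word -> word) : Prop :=
  bijective t /\ t [::] = [::] /\
  (forall (v : word) (x : X), exists y : X, t (rcons v x) = rcons (t v) y).

(* Self-similar group: a group of tree automorphisms (faithful action, so G is
   identified with its image in Aut X^{*}) such that g(xw) = y h(w). *)
Definition self_similar_group (G : (word -> word) -> Prop) : Prop :=
  (forall g, G g -> tree_aut g) /\
  G id /\
  (forall g h, G g -> G h -> G (g \o h)) /\
  (forall g g', G g -> cancel g g' -> cancel g' g -> G g') /\
  (forall g (x : X), G g -> exists h, exists y : X,
      G h /\ forall w : word, g (x :: w) = y :: h w).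

Definition act (t : word -> word) (w : iword) : iword :=
  fun n => nth (w n) (t (mkseq w n.+1)) n.

Definition icat (v : word) (w : iword) : iword :=
  fun n => if n < size v then nth (w 0) v n else w (n - size v).

Definition iprefix (v : word) (w : iword) : Prop := mkseq w (size v) = v.

Definition complete_antichain (A : seq word) : Prop :=
  uniq A /\
  (forall u v, u \in A -> v \in A -> u != v -> ~~ prefix u v) /\
  (forall w : iword, exists2 v, v \in A & iprefix v w).

(* Continuity for the product topology (X discrete). *)
Definition continuous (f : iword -> iword) : Prop :=
  forall (w : iword) (n : nat), exists m : nat, forall w' : iword,
    (forall i, i < m -> w' i = w i) -> forall i, i < n -> f w' i = f w i.

Definition homeomorphism (f : iword -> iword) : Prop :=
  exists f', [/\ cancel f f', cancel f' f, continuous f & continuous f'].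

Definition VG (G : (word -> word) -> Prop) (g : iword -> iword) : Prop :=
  homeomorphism g /\
  exists (A1 A2 : seq word) (alpha : word -> word) (gv : word -> word -> word),
    complete_antichain A1 /\ complete_antichain A2 /\
    (forall v, v \in A1 -> alpha v \in A2) /\
    {in A1 &, injective alpha} /\
    (forall u, u \in A2 -> exists2 v, v \in A1 & alpha v = u) /\
    (forall v, v \in A1 -> G (gv v)) /\
    (forall v, v \in A1 -> forall w : iword,
        g (icat v w) = icat (alpha v) (act (gv v) w)).

(* Commutator subgroup K' of a group K of bijections: the subgroup generated by
   commutators a^-1 b^-1 a b (a set closed under inverses), i.e. all finite
   products of commutators. *)
Inductive commutator_subgroup (K : (iword -> iword) -> Prop) :
    (iword -> iword) -> Prop :=
  | comm_id : commutator_subgroup K id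
  | comm_step a a' b b' h :
      K a -> K b -> cancel a a' -> cancel a' a -> cancel b b' -> cancel b' b ->
      commutator_subgroup K h ->
      commutator_subgroup K (a' \o b' \o a \o b \o h).

Definition normal_subgroup (N K : (iword -> iword) -> Prop) : Prop :=
  (forall f, N f -> K f) /\ N id /\
  (forall f g, N f -> N g -> N (f \o g)) /\
  (forall f f', N f -> cancel f f' -> cancel f' f -> N f') /\
  (forall k k' f, K k -> cancel k k' -> cancel k' k -> N f -> N (k' \o f \o k)).

Definition simple_group (K : (iword -> iword) -> Prop) : Prop :=
  (exists f, K f /\ f <> id) /\
  forall N, normal_subgroup N K ->
    (forall f, N f -> f = id) \/ (forall f, K f -> N f).

End SelfSimilar.

(* Main.v *)
(* Every a in V_G is a product of two elements, each fixing some cylinder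
   pointwise, and an involution exchanging the complement of a cylinder e with
   a copy of that complement inside any subcylinder of e lies in V_G.
   Consequently every g in V_G agrees, outside a prescribed cylinder, with
   some element of V_G'.
   Let N be a nontrivial normal subgroup of V_G' and let f in N move a cylinder
   off itself.  The double-commutator trick with f shows that [a, b] is in N
   whenever a, b in V_G both fix a common cylinder: compress the supports of a
   and b into the moved cylinder by an element of V_G'.  This class of pairs is
   invariant under V_G, so these commutators lie in the core M of N, the largest
   subgroup of N normalised by V_G.
   If a fixes u and b fixes u' disjoint from u, then a is congruent mod M to a
   conjugate supported in u, which shares the fixed cylinder u' with b.  Hence
   generators of V_G commute mod M, so V_G' is contained in M. *)
Require Import Defs.
From mathcomp Require Import all_boot.
From Stdlib Require Import FunctionalExtensionality Classical.
Set Implicit Arguments. Unset Strict Implicit. Unset Printing Implicit Defensive.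

(** * Finite words, infinite words and cylinders *)

Section Words.
Variable X : finType.
Implicit Types (v u e : word X) (w : iword X).

Definition idrop n w : iword X := fun i => w (n + i).
Definition in_cyl v w := mkseq w (size v) == v.

(** The offset [m] skips the prefixes shorter than a given head, so that [mkseq_icat] applies to
    every prefix compared. *)
Lemma iword_eq m w w' :
  (forall n, mkseq w (m + n) = mkseq w' (m + n)) -> w = w'.
Proof.
move=> eq_ww'; apply: functional_extensionality => n.
have := congr1 (fun s => nth (w n) s n) (eq_ww' n.+1).
by rewrite !nth_mkseq // addnS ltnS leq_addl.
Qed.

Lemma mkseq_icat v w n : mkseq (icat v w) (size v + n) = v ++ mkseq w n.
Proof.
apply: (@eq_from_nth _ (w 0)) => [|i].
  by rewrite size_cat !size_mkseq.
rewrite size_mkseq => lti; rewrite nth_mkseq // nth_cat /icat.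
case: ltnP => // le_vi; rewrite nth_mkseq //.
by rewrite ltn_subLR.
Qed.

Lemma mkseq_icat_size v w : mkseq (icat v w) (size v) = v.
Proof. by have := mkseq_icat v w 0; rewrite addn0 cats0. Qed.

Lemma icat_cat v u w : icat (v ++ u) w = icat v (icat u w).
Proof.
apply: (@iword_eq (size (v ++ u))) => n.
by rewrite mkseq_icat size_cat -addnA !mkseq_icat catA.
Qed.

Lemma icat0 w : icat [::] w = w.
Proof. by apply: functional_extensionality => n; rewrite /icat /= subn0. Qed.

Lemma idrop_icat v w : idrop (size v) (icat v w) = w.
Proof.
apply: functional_extensionality => n.
by rewrite /idrop /icat ltnNge leq_addr /= addKn.
Qed.

Lemma icat_mkseq w n : icat (mkseq w n) (idrop n w) = w.
Proof.
apply: functional_extensionality => i; rewrite /icat size_mkseq /idrop.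
by case: ltnP => [lt_in|le_ni]; rewrite ?nth_mkseq // subnKC.
Qed.

Lemma in_cyl_icat v w : in_cyl v (icat v w).
Proof. by rewrite /in_cyl mkseq_icat_size. Qed.

Lemma in_cylE v w : in_cyl v w -> w = icat v (idrop (size v) w).
Proof. by move=> /eqP wv; rewrite -[v in icat v _]wv icat_mkseq. Qed.

Lemma take_mkseq_le w m n : m <= n -> take m (mkseq w n) = mkseq w m.
Proof.
by move=> le_mn; rewrite /mkseq -map_take take_iota; move/minn_idPl: le_mn => ->.
Qed.

Lemma in_cyl_cat v u w : in_cyl (v ++ u) w -> in_cyl v w.
Proof. by move=> /in_cylE ->; rewrite icat_cat in_cyl_icat. Qed.

Lemma in_cyl_prefix v u w : in_cyl v w -> in_cyl u w -> size v <= size u ->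
  prefix v u.
Proof.
by move=> /eqP <- /eqP <-; rewrite !size_mkseq prefixE size_mkseq => /take_mkseq_le ->.
Qed.

Lemma in_cyl_comparable v u w : in_cyl v w -> in_cyl u w ->
  prefix v u || prefix u v.
Proof.
move=> wv wu; have [/(in_cyl_prefix wv wu)-> //|/ltnW] := leqP (size v) (size u).
by move=> /(in_cyl_prefix wu wv) ->; rewrite orbT.
Qed.

Lemma in_cyl_icat_prefix v u w : size v <= size u ->
  in_cyl v (icat u w) = prefix v u.
Proof.
move=> le_vu; apply/idP/idP => [wv|/prefixP[r ->]].
  exact: (in_cyl_prefix wv (in_cyl_icat u w)).
by rewrite icat_cat in_cyl_icat.
Qed.

Lemma in_cyl_agree v w w' : in_cyl v w ->
  (forall i, i < size v -> w' i = w i) -> in_cyl v w'.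
Proof.
move=> /eqP wv eq_ww'; apply/eqP; rewrite -[RHS]wv; apply/eq_in_map => i.
by rewrite mem_iota => /eq_ww'.
Qed.

Lemma in_cyl_nth v w w' i : in_cyl v w -> in_cyl v w' -> i < size v ->
  w i = w' i.
Proof.
move=> /eqP wv /eqP wv' lti.
by have := congr1 (fun s => nth (w i) s i) (etrans wv (esym wv')); rewrite !nth_mkseq.
Qed.

End Words.

(** * Maps that act on all deep cylinders through elements of G *)

Section LocalAction.
Variables (X : finType) (w0 : iword X) (G : (word X -> word X) -> Prop).
Hypothesis hG : self_similar_group G.
Implicit Types (v u e : word X) (w : iword X) (g h : word X -> word X).

Lemma self_similar_cat g u : G g ->
  exists2 h, G h & forall v, g (u ++ v) = g u ++ h v.
Proof.
have [aut [_ [_ [_ sec]]]] := hG.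
elim: u g => [|x u IHu] g Gg.
  by exists g => // v; have [_ [-> _]] := aut g Gg.
have [h1 [y [Gh1 gx]]] := sec g x Gg; have [h Gh h1u] := IHu h1 Gh1.
by exists h => // v; rewrite /= !gx h1u.
Qed.

Lemma size_self_similar g v : G g -> size (g v) = size v.
Proof.
move=> Gg; have [aut _] := hG; have [_ [g0 grcons]] := aut g Gg.
elim/last_ind: v => [|v x IHv]; first by rewrite g0.
by have [y ->] := grcons v x; rewrite !size_rcons IHv.
Qed.

(** [act] reads letter [n] off the image of the prefix of length [n.+1]; these letters are coherent
    because [g] respects prefixes. *)
Lemma mkseq_act g w n : G g -> mkseq (act g w) n = g (mkseq w n).
Proof.
move=> Gg; have [aut _] := hG; have [_ [g0 grcons]] := aut g Gg.
have mkseqSr (w' : iword X) m : mkseq w' m.+1 = rcons (mkseq w' m) (w' m).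
  by rewrite /mkseq -addn1 iotaD map_cat /= add0n cats1.
elim: n => [|n IHn]; first by rewrite [mkseq w 0]/= g0.
rewrite mkseqSr IHn /act mkseqSr; have [y gy] := grcons (mkseq w n) (w n).
rewrite gy nth_rcons (size_self_similar _ Gg) size_mkseq ltnn eqxx.
by [].
Qed.

Lemma act_icat g u : G g ->
  exists2 h, G h & forall w, act g (icat u w) = icat (g u) (act h w).
Proof.
move=> Gg; have [h Gh gu] := self_similar_cat u Gg; exists h => // w.
apply: (@iword_eq _ (size u)) => n; rewrite mkseq_act // mkseq_icat gu.
by rewrite -(size_self_similar u Gg) mkseq_icat mkseq_act.
Qed.

Lemma act_comp g h : G g -> G h -> act (g \o h) =1 act g \o act h.
Proof.
have [_ [_ [Gcomp _]]] := hG; move=> Gg Gh w.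
apply: (@iword_eq _ 0) => n.
by rewrite /= mkseq_act ?mkseq_act //; apply: Gcomp.
Qed.

Lemma act_id w : act id w = w.
Proof.
by apply: functional_extensionality => n; rewrite /act nth_mkseq.
Qed.

Lemma act_inv g : G g -> exists g', [/\ G g', cancel (act g) (act g')
  & cancel (act g') (act g)].
Proof.
move=> Gg; have [aut [_ [_ [Ginv _]]]] := hG.
have [[g' gK gK'] _] := aut g Gg; have Gg' := Ginv g g' Gg gK gK'.
by exists g'; split=> // w; apply: (@iword_eq _ 0) => n;
  rewrite !mkseq_act // ?gK ?gK'.
Qed.

Definition acts_on_cyl f v := exists v' h, G h /\
  forall w, f (icat v w) = icat v' (act h w).

(** An antichain-free form of membership in V_G, equivalent to it for bijections. It also covers
    non-bijective maps such as [icat c] and [idrop n], from which elements of V_G are glued. *)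
Definition locally_G f := exists n, forall v, n <= size v -> acts_on_cyl f v.

Lemma acts_on_cyl_cat f v u : acts_on_cyl f v -> exists v' h,
  [/\ G h, size u <= size v' &
      forall w, f (icat (v ++ u) w) = icat v' (act h w)].
Proof.
move=> [v' [h [Gh fv]]]; have [k Gk hu] := act_icat u Gh.
exists (v' ++ h u), k; split => [//||w].
  by rewrite size_cat size_self_similar // leq_addl.
by rewrite icat_cat fv hu icat_cat.
Qed.

(** The letters of [v] beyond the depth of [f] pass through an element of G, which preserves length,
    so the image prefix gains as many letters. *)
Lemma locally_G_deep f m : locally_G f -> exists n, forall v, n <= size v ->
  exists v' h, [/\ G h, m <= size v' &
      forall w, f (icat v w) = icat v' (act h w)].
Proof.
move=> [n locf]; exists (n + m) => v le_v.
have le_n : n <= size v := leq_trans (leq_addr m n) le_v.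
have sz_n : size (take n v) = n by rewrite size_take_min; apply/minn_idPl.
have [|v' [h [Gh le_v' fv]]] := @acts_on_cyl_cat f (take n v) (drop n v).
  by apply: locf; rewrite sz_n.
exists v', h; split=> // [|w]; last by rewrite -fv cat_take_drop.
by apply: leq_trans le_v'; rewrite size_drop leq_subRL.
Qed.

Lemma acts_on_cyl_locally_G f n :
  (forall v, size v = n -> acts_on_cyl f v) -> locally_G f.
Proof.
move=> locf; exists n => v le_v.
have sz_n : size (take n v) = n by rewrite size_take_min; apply/minn_idPl.
have [v' [h [Gh _ fv]]] := acts_on_cyl_cat (drop n v) (locf _ sz_n).
by exists v', h; split=> // w; rewrite -fv cat_take_drop.
Qed.

Lemma locally_G_comp f1 f2 :
  locally_G f1 -> locally_G f2 -> locally_G (f1 \o f2).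
Proof.
have [_ [_ [Gcomp _]]] := hG.
move=> [m loc1] /(locally_G_deep m)[n loc2]; exists n => v /loc2.
move=> [v' [h [Gh /loc1[v'' [k [Gk f1v']]] f2v]]].
exists v'', (k \o h); split; first exact: Gcomp.
by move=> w; rewrite /= f2v f1v' act_comp.
Qed.

Lemma locally_G_continuous f : locally_G f -> continuous f.
Proof.
move=> locf w n; have [m locfn] := locally_G_deep n locf.
exists m => w' eq_ww' i lt_in.
have [|v' [h [_ le_v' fv]]] := locfn (mkseq w m); first by rewrite size_mkseq.
have fin w'' : in_cyl (mkseq w m) w'' -> in_cyl v' (f w'').
  by move=> /in_cylE ->; rewrite fv in_cyl_icat.
have w_in : in_cyl (mkseq w m) w by rewrite /in_cyl size_mkseq.
apply: (@in_cyl_nth _ v'); [apply: fin|exact: fin|exact: leq_trans le_v'].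
by apply: in_cyl_agree w_in _ => j; rewrite size_mkseq => /eq_ww'.
Qed.

Lemma locally_G_inv f f' : cancel f f' -> cancel f' f ->
  locally_G f -> locally_G f'.
Proof.
move=> fK fK' [n locf].
have /fin_all_exists[al Hal] (t : n.-tuple X) : exists v', exists h, G h /\
    forall w, f (icat t w) = icat v' (act h w).
  by apply: locf; rewrite size_tuple.
(* The image of each cylinder of depth [n] is a whole cylinder [al t]. A word [z] at least as long
   as all of these extends one that contains [icat z w0]. *)
exists (\max_t size (al t)) => z le_z.
pose q := f' (icat z w0); pose t := [tuple of mkseq q n].
have [h [Gh ft]] := Hal t; have [h' [Gh' hK hK']] := act_inv Gh.
have /prefixP[r zE] : prefix (al t) z.
  apply: in_cyl_prefix (_ : in_cyl _ (icat z w0)) (in_cyl_icat z w0) _.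
    by rewrite -[icat z w0]fK' -/q -(icat_mkseq q n) (ft (idrop n q)) in_cyl_icat.
  by apply: leq_trans le_z; apply: leq_bigmax.
have [k Gk h'r] := act_icat r Gh'.
exists (tval t ++ h' r), k; split=> // w; apply: (can_inj fK).
by rewrite fK' icat_cat -h'r ft hK' zE icat_cat.
Qed.

Lemma VG_locally_G f : VG G f -> locally_G f.
Proof.
move=> [_ [A1 [A2 [al [gv [[_ [_ cov]] [_ [_ [_ [_ [Ggv fA]]]]]]]]]]].
exists (\max_(v <- A1) size v) => z le_z.
have [v vA1 zv] := cov (icat z w0).
have /prefixP[r ->] : prefix v z.
  apply: in_cyl_prefix (introT eqP zv) (in_cyl_icat z w0) _.
  by apply: leq_trans le_z; rewrite leq_bigmax_seq.
have actv : acts_on_cyl f v.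
  by exists (al v), (gv v); split=> [|w]; [apply: Ggv | apply: fA].
by have [v' [h [Gh _ fv]]] := acts_on_cyl_cat r actv; exists v', h.
Qed.

(** The source antichain is the set of all words of length [n]; the target antichain is the set of
    heads of their image cylinders. *)
Lemma locally_G_VG f f' : cancel f f' -> cancel f' f -> locally_G f -> VG G f.
Proof.
move=> fK fK' locf; split.
  exists f'; split=> //; apply: locally_G_continuous => //.
  exact: locally_G_inv fK fK' locf.
have [n locfn] := locf.
have /fin_all_exists2[al Gal Hal] (t : n.-tuple X) :
    exists2 p : word X * (word X -> word X),
    G p.2 & forall w, f (icat t w) = icat p.1 (act p.2 w).
  have [|v' [h [Gh fv]]] := locfn t; first by rewrite size_tuple.
  by exists (v', h).
pose dflt := [tuple of mkseq w0 n]; pose al1 v := al (insubd dflt v).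
(* Elements of G act onto, so comparable heads mean overlapping images, and injectivity of [f] gives
   [s = t]. This yields both the antichain property and the injectivity of [alpha]. *)
have inj_al (s t : n.-tuple X) : prefix (al s).1 (al t).1 -> s = t.
  move=> /prefixP[r al_t].
  have [hs [_ hsK hsK']] := act_inv (Gal s).
  have [ht [_ htK htK']] := act_inv (Gal t).
  have: f (icat t (act ht w0)) = f (icat s (act hs (icat r w0))).
    by rewrite !Hal htK' hsK' al_t icat_cat.
  move=> /(can_inj fK) eq_st; apply: val_inj => /=.
  rewrite -(mkseq_icat_size (tval s) (act hs (icat r w0))) -eq_st size_tuple.
  by rewrite -{2}(size_tuple t) mkseq_icat_size.
have al1E (t : n.-tuple X) : al1 t = al t by rewrite /al1 valKd.
exists (map val (enum {: n.-tuple X})), (map (fun t => (al t).1) (enum {: n.-tuple X})).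
exists (fun v => (al1 v).1), (fun v => (al1 v).2).
split; [|split; [|split; [|split; [|split; [|split]]]]].
- split; first by rewrite (map_inj_uniq val_inj) enum_uniq.
  split=> [_ _ /mapP[s _ ->] /mapP[t _ ->]|w].
    by apply: contra; rewrite prefixE !size_tuple take_oversize ?size_tuple // eq_sym.
  exists (mkseq w n); last by rewrite /iprefix size_mkseq.
  by apply/mapP; exists [tuple of mkseq w n]; rewrite ?mem_enum.
- split.
    by rewrite map_inj_uniq ?enum_uniq // => s t eq_st; apply: inj_al; rewrite eq_st prefix_refl.
  split=> [_ _ /mapP[s _ ->] /mapP[t _ ->]|w].
    by apply: contra => /inj_al ->.
  exists (al [tuple of mkseq (f' w) n]).1; first by apply/mapP; exists [tuple of mkseq (f' w) n]; rewrite ?mem_enum.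
  have := Hal [tuple of mkseq (f' w) n] (idrop n (f' w)).
  by rewrite icat_mkseq fK' /iprefix => wE; rewrite [in mkseq w]wE mkseq_icat_size.
- move=> _ /mapP[t _ ->]; rewrite al1E; apply/mapP; exists t => //.
  by rewrite mem_enum.
- move=> _ _ /mapP[s _ ->] /mapP[t _ ->]; rewrite !al1E => eq_st.
  by congr val; apply: inj_al; rewrite eq_st prefix_refl.
- move=> _ /mapP[t _ ->]; exists (val t); last by rewrite al1E.
  by apply/mapP; exists t; rewrite ?mem_enum.
- by move=> _ /mapP[t _ ->]; rewrite al1E; apply: Gal.
- by move=> _ /mapP[t _ ->] w; rewrite al1E Hal.
Qed.

End LocalAction.

(** * Inverse pairs, exchanges and commutators on an arbitrary type *)

Definition inverses (T : Type) (f f' : T -> T) := cancel f f' /\ cancel f' f.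

Lemma inverses_sym (T : Type) (f f' : T -> T) : inverses f f' -> inverses f' f.
Proof. by case. Qed.

Lemma inverses_comp (T : Type) (f f' g g' : T -> T) :
  inverses f f' -> inverses g g' -> inverses (f \o g) (g' \o f').
Proof.
by move=> [fK fK'] [gK gK']; split; apply: can_comp.
Qed.

Definition flip (T : Type) (C D : pred T) (f f' : T -> T) w :=
  if C w then f w else if D w then f' w else w.

Lemma flipK (T : Type) (C D : pred T) (f f' : T -> T) :
  (forall w, C w -> D (f w) /\ f' (f w) = w) ->
  (forall w, D w -> [/\ C (f' w), f (f' w) = w & ~~ C w]) ->
  involutive (flip C D f f').
Proof.
move=> CD DC w; rewrite {2}/flip; case: ifPn => [Cw|nCw].
  have [Dfw fwK] := CD w Cw; have [_ _ /negbTE nCfw] := DC _ Dfw.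
  by rewrite /flip nCfw Dfw.
case: ifPn => [Dw|nDw]; last by rewrite /flip (negbTE nCw) (negbTE nDw).
by have [Cf'w f'wK _] := DC w Dw; rewrite /flip Cf'w.
Qed.

(* On P the pairs act alike, on Q only b acts, and elsewhere only k acts. *)
Lemma commutator_local (T : Type) (P Q : pred T) (k k' b b' a1 a1' b1 b1' : T -> T) :
  inverses k k' -> inverses b b' -> inverses a1 a1' -> inverses b1 b1' ->
  (forall w, P w -> k w = a1 w) -> (forall w, P w -> b w = b1 w) ->
  (forall w, ~~ P w -> a1 w = w) -> (forall w, ~~ P w -> b1 w = w) ->
  (forall w, Q w -> k w = w) -> (forall w, ~~ P w -> ~~ Q w -> b w = w) ->
  (forall w, P w -> ~~ Q w) ->
  k' \o b' \o k \o b = a1' \o b1' \o a1 \o b1.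
Proof.
move=> [kK kK'] [bK bK'] [aK aK'] [b1K b1K'] ka bb1 aP b1P kQ bPQ PQ.
(* A bijection that is the identity off [P] preserves [P], and so does its inverse. *)
have stab f f' : cancel f f' -> cancel f' f -> (forall w, ~~ P w -> f w = w) ->
    forall w, P (f w) = P w /\ P (f' w) = P w.
  move=> fK fK' fP w.
  have Pf u : P (f u) = P u.
    have [Pu|nPu] := boolP (P u); last by rewrite fP // (negbTE nPu).
    by apply: contraT => nPfu; have fu := can_inj fK (fP _ nPfu); rewrite fu Pu in nPfu.
  by split; rewrite ?Pf // -[in RHS](fK' w) Pf.
have Pa w := proj1 (stab _ _ aK aK' aP w); have Pa' w := proj2 (stab _ _ aK aK' aP w).
have Pb w := proj1 (stab _ _ b1K b1K' b1P w); have Pb' w := proj2 (stab _ _ b1K b1K' b1P w).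
have k'a w : P w -> k' w = a1' w.
  by move=> Pw; apply: (can_inj kK); rewrite kK' ka ?Pa' // aK'.
have b'b w : P w -> b' w = b1' w.
  by move=> Pw; apply: (can_inj bK); rewrite bK' bb1 ?Pb' // b1K'.
apply: functional_extensionality => w /=.
have [Pw|nPw] := boolP (P w).
  by rewrite (bb1 w) // ka ?Pb // b'b ?Pa ?Pb // k'a // Pb' Pa Pb.
(* A bijection agreeing on [P] with one that preserves [P] maps [P] onto itself, hence preserves the
   complement too. *)
have nP_bij f f' f1 f1' : cancel f f' -> cancel f1' f1 ->
    (forall u, P u -> f u = f1 u) -> (forall u, P (f1' u) = P u) ->
    forall u, ~~ P u -> ~~ P (f u).
  move=> fK f1K' ff1 Pf1' u; apply: contra => Pfu.
  have <- : f1' (f u) = u by apply: (can_inj fK); rewrite ff1 ?Pf1' // f1K'.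
  by rewrite Pf1'.
have -> : a1' (b1' (a1 (b1 w))) = w.
  by rewrite (b1P w) // (aP w) // -{1}(b1P w) // b1K -{1}(aP w) // aK.
(* On [Q], [k] fixes both [w] and [b w]; off [P] and [Q], [b] fixes both [w] and [k w]. Either way
   the commutator collapses. *)
have [Qw|nQw] := boolP (Q w).
  have nPbw := nP_bij _ _ _ _ bK b1K' bb1 Pb' w nPw.
  have Qbw : Q (b w).
    by apply: contraT => nQ; have bw := can_inj bK (bPQ _ nPbw nQ); rewrite bw Qw in nQ.
  by rewrite kQ // bK -{1}(kQ w) // kK.
rewrite (bPQ w) //.
have nPkw := nP_bij _ _ _ _ kK aK' ka Pa' w nPw.
have nQkw : ~~ Q (k w).
  by apply: contra nQw => Qk; rewrite -(can_inj kK (kQ _ Qk)).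
by rewrite -{1}(bPQ (k w)) // bK kK.
Qed.

(** * Gluing elements of V_G from local pieces *)

Section Generation.
Variables (X : finType) (x y : X) (G : (word X -> word X) -> Prop).
Hypotheses (neq_xy : x != y) (hG : self_similar_group G).
Implicit Types (v u e r : word X) (w : iword X) (f g a b t : iword X -> iword X).

Let w0 : iword X := fun=> x.
Local Notation V := (VG G).
Local Notation D := (commutator_subgroup V).

(** Membership is decided by a prefix of uniformly bounded length; by compactness these are exactly
    the clopen sets. *)
Definition clopen (P : pred (iword X)) := exists n, forall v w w',
  n <= size v -> P (icat v w) = P (icat v w').

Lemma clopen_in_cyl e : clopen (in_cyl e).
Proof. by exists (size e) => v w w' le_ev; rewrite !in_cyl_icat_prefix. Qed.

Lemma clopen_comp P f : clopen P -> locally_G G f -> clopen (P \o f).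
Proof.
move=> [m cP] locf; have [n locfm] := locally_G_deep hG m locf.
exists n => v w w' /locfm[v' [h [_ le_v' fv]]].
by rewrite /= !fv; apply: cP.
Qed.

Lemma locally_G_if P f1 f2 : clopen P -> locally_G G f1 -> locally_G G f2 ->
  locally_G G (fun w => if P w then f1 w else f2 w).
Proof.
move=> [m cP] [n1 loc1] [n2 loc2]; exists (maxn m (maxn n1 n2)) => v.
rewrite !geq_max => /and3P[le_m /loc1[v1 [h1 [Gh1 f1v]]] /loc2[v2 [h2 [Gh2 f2v]]]].
case Pv: (P (icat v w0)).
  by exists v1, h1; split=> // w; rewrite (cP v w w0) // Pv f1v.
by exists v2, h2; split=> // w; rewrite (cP v w w0) // Pv f2v.
Qed.

Lemma G_id : G id. Proof. by case: hG => _ []. Qed.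

Lemma locally_G_id : locally_G G id.
Proof. by exists 0 => v _; exists v, id; split=> [|w]; rewrite ?act_id //; apply: G_id. Qed.

Lemma locally_G_icat c : locally_G G (icat c).
Proof.
exists 0 => v _; exists (c ++ v), id; split=> [|w]; first exact: G_id.
by rewrite act_id icat_cat.
Qed.

Lemma locally_G_idrop n : locally_G G (idrop n).
Proof.
apply: (@acts_on_cyl_locally_G _ _ hG _ n) => v sz_v; exists [::], id.
by split=> [|w]; [apply: G_id | rewrite act_id icat0 -sz_v idrop_icat].
Qed.

Lemma VG_intro f f' : inverses f f' -> locally_G G f -> V f.
Proof. by case; apply: locally_G_VG w0 _ hG f f'. Qed.

Lemma VG_inv f : V f -> exists2 f', inverses f f' & V f'.
Proof.
move=> Vf; have [[f' [fK fK' _ _]] _] := Vf; exists f'; first by [].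
apply: (@VG_intro _ f) => //.
exact: (locally_G_inv w0 hG fK fK' (VG_locally_G w0 hG Vf)).
Qed.

Lemma VG_inverse f f' : V f -> inverses f f' -> V f'.
Proof.
move=> /VG_inv[g [fK fK'] Vg] [fK1 _].
rewrite (_ : f' = g) //; apply: functional_extensionality => w.
by rewrite -[w in LHS]fK' fK1.
Qed.

Lemma VG_comp f g : V f -> V g -> V (f \o g).
Proof.
move=> Vf Vg; have [f' ff' _] := VG_inv Vf; have [g' gg' _] := VG_inv Vg.
apply: VG_intro (inverses_comp ff' gg') _.
by apply: locally_G_comp => //; apply: (VG_locally_G w0).
Qed.

Lemma VG_id : V id.
Proof. by apply: (@VG_intro _ id) => //; apply: locally_G_id. Qed.

Lemma VG_conj f k k' : V f -> V k -> inverses k k' -> V (k' \o f \o k).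
Proof. by move=> Vf Vk /(VG_inverse Vk) Vk'; do ![apply: VG_comp => //]. Qed.

Lemma VG_flip C E f f' : clopen C -> clopen E ->
  locally_G G f -> locally_G G f' -> involutive (flip C E f f') ->
  V (flip C E f f').
Proof.
move=> cC cE locf locf' flK; apply: (@VG_intro _ (flip C E f f')) => //.
by do 2![apply: locally_G_if => //]; apply: locally_G_id.
Qed.

(** * Exchanging, compressing and moving cylinders *)

Definition fixes e f := forall w, in_cyl e w -> f w = w.

Lemma fixes_cat e r f : fixes e f -> fixes (e ++ r) f.
Proof. by move=> fe w /in_cyl_cat/fe. Qed.

Lemma fixes_inv e f f' : inverses f f' -> fixes e f -> fixes e f'.
Proof. by move=> [fK _] fe w we; rewrite -{1}(fe w we) fK. Qed.

(* The involution exchanging the complement of e with its copy inside er. *)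
Definition cyl_flip e r :=
  flip (fun w => ~~ in_cyl e w)
       (fun w => in_cyl (e ++ r) w && ~~ in_cyl e (idrop (size (e ++ r)) w))
       (icat (e ++ r)) (idrop (size (e ++ r))).

Lemma cyl_flipK e r : involutive (cyl_flip e r).
Proof.
apply: flipK => w; first by rewrite in_cyl_icat idrop_icat.
move=> /andP[wer nwe]; split=> //; first by rewrite -in_cylE.
by rewrite negbK (in_cyl_cat wer).
Qed.

Lemma cyl_flip_inverses e r : inverses (cyl_flip e r) (cyl_flip e r).
Proof. by split; apply: cyl_flipK. Qed.

Lemma VG_cyl_flip e r : V (cyl_flip e r).
Proof.
have neg P : clopen P -> clopen (fun w => ~~ P w).
  by move=> [n cP]; exists n => v w w' le_v; rewrite (cP v w w').
apply: VG_flip; [| |exact: locally_G_icat|exact: locally_G_idrop|exact: cyl_flipK].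
  exact/neg/clopen_in_cyl.
have [n c1] := clopen_in_cyl (e ++ r).
have [m c2] := clopen_comp (neg _ (clopen_in_cyl e)) (locally_G_idrop (size (e ++ r))).
exists (maxn n m) => v w w'; rewrite geq_max => /andP[le_n le_m].
by rewrite (c1 v w w') //; congr andb; apply: c2.
Qed.

Lemma cyl_flip_out e r w : ~~ in_cyl e w -> cyl_flip e r w = icat (e ++ r) w.
Proof. by rewrite /cyl_flip /flip => ->. Qed.

Lemma cyl_flip_icat e r w : ~~ in_cyl e w -> cyl_flip e r (icat (e ++ r) w) = w.
Proof. by move=> nwe; rewrite -cyl_flip_out // cyl_flipK. Qed.

(** The cylinder of [(e ++ r) ++ e] is what the copy of the complement of [e] leaves free inside
    [e ++ r]. *)
Lemma cyl_flip_fixes e r : fixes ((e ++ r) ++ e) (cyl_flip e r).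
Proof.
move=> w w_in; rewrite /cyl_flip /flip (in_cyl_cat (in_cyl_cat w_in)) /=.
by rewrite (in_cylE w_in) icat_cat idrop_icat !in_cyl_icat.
Qed.

Lemma compress_off_cyl e u : exists t t', [/\ V t, inverses t t' &
  forall w, ~~ in_cyl e w -> in_cyl u (t w)].
Proof.
have [/prefixP[r ->]|n_eu] := boolP (prefix e u).
  exists (cyl_flip e r), (cyl_flip e r).
  split; [exact: VG_cyl_flip|exact: cyl_flip_inverses|move=> w nwe].
  by rewrite cyl_flip_out ?in_cyl_icat.
have [/prefixP[r ->]|n_ue] := boolP (prefix u e).
  exists (cyl_flip (u ++ r) [::]), (cyl_flip (u ++ r) [::]).
  split; [exact: VG_cyl_flip|exact: cyl_flip_inverses|move=> w nwe].
  by rewrite cyl_flip_out // cats0 icat_cat in_cyl_icat.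
(* For incomparable [e] and [u], the complement of [e] first goes into the cylinder of [e ++ u]; the
   second exchange strips [e], since the cylinder of [u] lies outside that of [e]. *)
exists (cyl_flip e [::] \o cyl_flip e u), (cyl_flip e u \o cyl_flip e [::]).
split; [|by apply: inverses_comp; apply: cyl_flip_inverses|move=> w nwe].
  by apply: VG_comp; apply: VG_cyl_flip.
rewrite /= (cyl_flip_out u nwe) icat_cat -{2}[e]cats0 cyl_flip_icat ?in_cyl_icat //.
apply/negP => /in_cyl_comparable/(_ (in_cyl_icat u w)).
by rewrite (negbTE n_eu) (negbTE n_ue).
Qed.

Lemma moved_cyl f : V f -> f <> id ->
  exists v, forall w, in_cyl v w -> ~~ in_cyl v (f w).
Proof.
move=> [[_ [_ _ contf _]] _] f_nid.
have [w [i /eqP fwi]] : exists w i, f w i <> w i.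
  apply: NNPP => nex; apply: f_nid; apply: functional_extensionality => w.
  apply: functional_extensionality => i; apply: NNPP => fwi.
  by apply: nex; exists w, i.
(* The first [m] letters determine letter [i] of the image, and the further [i.+1] letters make the
   cylinder prescribe letter [i] itself. *)
have [m eq_fw] := contf w i.+1; exists (mkseq w (m + i.+1)) => w' w'v.
have wv : in_cyl (mkseq w (m + i.+1)) w by rewrite /in_cyl size_mkseq.
have fw'i : f w' i = f w i.
  apply: eq_fw => // j lt_jm; apply: in_cyl_nth w'v wv _.
  by rewrite size_mkseq ltn_addr.
apply: contra fwi => fw'v; rewrite -fw'i; apply/eqP/(in_cyl_nth fw'v wv).
by rewrite size_mkseq addnS ltnS leq_addl.
Qed.

Lemma preimage_cyl f u : V f -> exists z, forall w, in_cyl z w -> in_cyl u (f w).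
Proof.
move=> [[f' [_ fK' contf _]] _]; have [m fu] := contf (f' (icat u w0)) (size u).
exists (mkseq (f' (icat u w0)) m) => w wz.
apply: (in_cyl_agree (in_cyl_icat u w0)) => i lt_iu.
rewrite -[in RHS](fK' (icat u w0)); apply: fu => // j lt_jm.
by apply: in_cyl_nth wz _ _; rewrite /in_cyl size_mkseq.
Qed.

Lemma cyl_siblings v w : in_cyl (v ++ [:: x]) w -> ~~ in_cyl (v ++ [:: y]) w.
Proof.
move=> wx; apply/negP => /(in_cyl_comparable wx).
by rewrite !prefix_catr // eqxx /= !andbT (eq_sym y) (negbTE neq_xy).
Qed.

(** If [a] moves [v] off itself, let [s] exchange [vx] with its image by [a] and [a^-1]. Then [s]
    fixes [vy], which meets neither set, while [s \o a] fixes [vx]. *)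
Lemma VG_factor a : V a -> exists a1 a2 v1 v2,
  [/\ V a1, V a2, fixes v1 a1, fixes v2 a2 & a = a1 \o a2].
Proof.
move=> Va; have [a_id|a_nid] := classic (a = id).
  by exists a, a, [::], [::]; split=> //; rewrite a_id.
have [v va] := moved_cyl Va a_nid; have [a' [aK aK'] Va'] := VG_inv Va.
pose s := flip (in_cyl (v ++ [:: x])) (in_cyl (v ++ [:: x]) \o a') a a'.
have av w : in_cyl (v ++ [:: x]) w -> ~~ in_cyl v (a w).
  by move=> /in_cyl_cat/va.
have sK : involutive s.
  apply: flipK => w /= w_in; first by rewrite aK.
  split=> //; apply: contra (av _ w_in); rewrite aK'.
  exact: in_cyl_cat.
have Vs : V s.
  have loc := VG_locally_G w0 hG.
  apply: VG_flip => //; [|apply: clopen_comp|apply: loc|apply: loc] => //;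
    try exact: clopen_in_cyl.
  exact: loc.
exists s, (s \o a), (v ++ [:: y]), (v ++ [:: x]); split=> //.
- exact: VG_comp.
- move=> w wy; rewrite /s /flip.
  have /negbTE -> : ~~ in_cyl (v ++ [:: x]) w.
    by apply: contraL wy; apply: cyl_siblings.
  case: ifPn => //= a'w; have := av _ a'w.
  by rewrite aK' (in_cyl_cat wy).
- move=> w wx; rewrite /= /s /flip /= aK wx.
  by rewrite ifN //; apply: contra (av w wx); apply: in_cyl_cat.
- by apply: functional_extensionality => w /=; rewrite sK.
Qed.

(** * Agreement of V_G with V_G' off a cylinder *)

Lemma commutator_comp f g : D f -> D g -> D (f \o g).
Proof.
move=> Df Dg; elim: Df => // a a' b b' h Va Vb aK aK' bK bK' _ Dhg.
exact: (comm_step Va Vb aK aK' bK bK' Dhg).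
Qed.

Lemma commutator_VG f : D f -> V f.
Proof.
elim=> [|a a' b b' h Va Vb aK aK' bK bK' _ Vh]; first exact: VG_id.
have Va' := VG_inverse Va (conj aK aK'); have Vb' := VG_inverse Vb (conj bK bK').
by do 4![apply: VG_comp => //].
Qed.

Definition agree_off e f g := forall w, ~~ in_cyl e w -> f w = g w.

(** If [g1] fixes [e] and [t] maps the complement of [e] into [u1], then [t^-1] maps the complement
    of [u1] into [e], so the commutator [g1 t g1^-1 t^-1] equals [g1] there. The general case
    follows by factoring [g]. *)
Lemma agree_off_commutator g u : V g -> exists2 g', D g' & agree_off u g' g.
Proof.
have one g1 e u1 : V g1 -> fixes e g1 -> exists2 g', D g' & agree_off u1 g' g1.
  move=> Vg ge; have [g' [gK gK'] Vg'] := VG_inv Vg.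
  have [t [t' [Vt [tK tK'] te]]] := compress_off_cyl e u1.
  exists (g1 \o t \o g' \o t' \o id).
    apply: (comm_step _ _ gK' gK tK' tK (comm_id _)) => //.
    exact: VG_inverse Vt (conj tK tK').
  move=> w nwu /=; have t'w : in_cyl e (t' w).
    by apply: contraR nwu => /te; rewrite tK'.
  by rewrite (fixes_inv (conj gK gK') ge) // tK'.
move=> /VG_factor[g1 [g2 [v1 [v2 [Vg1 Vg2 fix1 fix2 ->]]]]].
have [g2' [g2K g2K'] Vg2'] := VG_inv Vg2.
(* As [z] lies inside the image of [u] under [g2], points off [u] are sent off [z], where [h1]
   agrees with [g1]. *)
have [z zu] := preimage_cyl u Vg2'.
have [h1 Dh1 h1E] := one g1 v1 z Vg1 fix1.
have [h2 Dh2 h2E] := one g2 v2 u Vg2 fix2.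
exists (h1 \o h2); first exact: commutator_comp.
move=> w nwu; rewrite /= h2E // h1E //.
by apply: contra nwu => /zu; rewrite g2K.
Qed.

Lemma commutator_nontrivial : exists f, D f /\ f <> id.
Proof.
have [g Dg gE] := agree_off_commutator [:: x] (VG_cyl_flip [:: x] [::]).
exists g; split=> // g_id.
(* The exchange puts [x] in front of the constant sequence [y], changing its first letter. *)
have := gE (fun=> y).
rewrite cyl_flip_out /in_cyl /mkseq /= !eqseq_cons eq_sym (negbTE neq_xy) //=.
move=> /(_ isT); rewrite g_id => /(congr1 (fun w => w 0)) /= yx.
by move: neq_xy; rewrite [x](esym yx) eqxx.
Qed.

(** * Commutators inside a nontrivial normal subgroup N of V_G' *)

Section NormalSubgroup.
Variable N : (iword X -> iword X) -> Prop.
Hypothesis nN : normal_subgroup N D.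

Let N_D f : N f -> D f. Proof. by case: nN => + _; apply. Qed.
Let N_id : N id. Proof. by case: nN => _ []. Qed.
Let N_comp f g : N f -> N g -> N (f \o g).
Proof. by case: nN => _ [_ [+ _]]; apply. Qed.
Let N_inv f f' : N f -> inverses f f' -> N f'.
Proof. by move=> Nf [fK fK']; case: nN => _ [_ [_ [+ _]]]; apply; eassumption. Qed.
Let N_conj k k' f : D k -> inverses k k' -> N f -> N (k' \o f \o k).
Proof.
by move=> Dk [kK kK'] Nf; case: nN => _ [_ [_ [_ +]]]; apply.
Qed.

(* If f moves v off itself and al in V' equals a1 away from a cylinder of v,
   then k = f^-1 al^-1 f al lies in N and equals a1 on vx; likewise be stands
   for b1, and [k, be] = [a1, b1]. *)
Lemma commutator_supported_in_N f v a1 a1' b1 b1' :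
  N f -> (forall w, in_cyl v w -> ~~ in_cyl v (f w)) ->
  V a1 -> V b1 -> inverses a1 a1' -> inverses b1 b1' ->
  (forall w, ~~ in_cyl (v ++ [:: x]) w -> a1 w = w) ->
  (forall w, ~~ in_cyl (v ++ [:: x]) w -> b1 w = w) ->
  N (a1' \o b1' \o a1 \o b1).
Proof.
move=> Nf fv Va1 Vb1 aa' bb' aP bP.
have [f' ff' _] := VG_inv (commutator_VG (N_D Nf)).
set P := v ++ [:: x] in aP bP.
(* Two disjoint cylinders of [vy] absorb the errors: [al] may differ from [a1] only on [E1], and
   [be] from [b1] only on [E2]. *)
pose E1 := (v ++ [:: y]) ++ [:: x]; pose E2 := (v ++ [:: y]) ++ [:: y].
have P_y w : in_cyl (v ++ [:: y]) w -> ~~ in_cyl P w.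
  by apply: contraL; apply: cyl_siblings.
have P_E1 w : in_cyl P w -> ~~ in_cyl E1 w.
  by apply: contraL => /in_cyl_cat/P_y.
have P_E2 w : in_cyl P w -> ~~ in_cyl E2 w.
  by apply: contraL => /in_cyl_cat/P_y.
have E2_E1 w : in_cyl E2 w -> ~~ in_cyl E1 w.
  by apply: contraL; apply: cyl_siblings.
have [al Dal alE] := agree_off_commutator E1 Va1.
have [be Dbe beE] := agree_off_commutator E2 Vb1.
have [al' alal' _] := VG_inv (commutator_VG Dal).
have [be' bebe' _] := VG_inv (commutator_VG Dbe).
have al_out w : ~~ in_cyl v w -> al' w = w.
  move=> nwv; rewrite -{1}[w](_ : al w = w) ?(proj1 alal') //.
  rewrite alE; first by apply: aP; apply: contra nwv; apply: in_cyl_cat.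
  by apply: contra nwv => /in_cyl_cat/in_cyl_cat.
pose k := f' \o (al' \o f \o al); pose k' := (al' \o f' \o al) \o f.
have kk' : inverses k k'.
  rewrite /k /k'; apply: (inverses_comp (inverses_sym ff')).
  exact: inverses_comp (inverses_comp (inverses_sym alal') ff') alal'.
have Nf' := N_inv Nf ff'.
have Nk : N k by apply: N_comp => //; apply: N_conj.
(* [f] carries [al w] out of [v], where [al'] is trivial, and [f'] brings it back. *)
have kE w : in_cyl v (al w) -> k w = al w.
  by move=> /fv nv; rewrite /k /= al_out // (proj1 ff').
(* On [E2], the only place off [P] where [be] can act, [k] is trivial. *)
rewrite -(@commutator_local _ (in_cyl P) (in_cyl E2) k k' be be' a1 a1' b1 b1') //.
- exact: N_comp (N_inv Nk kk') (N_conj Dbe bebe' Nk).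
- move=> w wP; have alw := alE w (P_E1 w wP); rewrite kE alw //.
  apply: (@in_cyl_cat _ v [:: x]); apply: contraT => nP.
  by have aw := can_inj (proj1 aa') (aP _ nP); rewrite aw wP in nP.
- by move=> w /P_E2/beE.
- move=> w wE2; have alw : al w = w.
    rewrite alE ?E2_E1 // aP //; exact: P_y (in_cyl_cat wE2).
  by rewrite kE alw //; apply: in_cyl_cat (in_cyl_cat wE2).
- by move=> w nP nE2; rewrite beE // bP.
Qed.

Hypothesis ntN : exists f, N f /\ f <> id.

(** Conjugation by [g] squeezes both supports into [vx]. Since [g] lies in V_G' and not merely in
    V_G, undoing the conjugation stays in N. *)
Lemma commutator_fixing_in_N u a a' b b' : V a -> V b ->
  inverses a a' -> inverses b b' -> fixes u a -> fixes u b ->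
  N (a' \o b' \o a \o b).
Proof.
move=> Va Vb aa' bb' au bu; have [f [Nf f_nid]] := ntN.
have [v fv] := moved_cyl (commutator_VG (N_D Nf)) f_nid.
have [t [_ [Vt _ tu]]] := compress_off_cyl u (v ++ [:: x]).
have [g Dg gE] := agree_off_commutator u Vt.
have Vg := commutator_VG Dg; have [g' gg' Vg'] := VG_inv Vg.
have g'g := inverses_sym gg'; have [gK gK'] := gg'.
have supp c : fixes u c -> forall w, ~~ in_cyl (v ++ [:: x]) w -> (g \o c \o g') w = w.
  move=> cu w nw /=; rewrite cu ?gK' //; apply: contraR nw => ng'w.
  by rewrite -[w]gK' gE // tu.
have conj_inv c c' : inverses c c' -> inverses (g \o c \o g') (g \o c' \o g').
  move=> cc'.
  exact: inverses_comp (inverses_comp gg' cc') g'g.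
have := commutator_supported_in_N Nf fv (VG_conj Va Vg' g'g) (VG_conj Vb Vg' g'g)
  (conj_inv _ _ aa') (conj_inv _ _ bb') (supp a au) (supp b bu).
move=> /(N_conj Dg gg').
congr N; apply: functional_extensionality => w /=.
by rewrite !gK.
Qed.

(** * Commutation in V_G modulo the core of N *)

Definition core f := forall k k', V k -> inverses k k' -> N (k' \o f \o k).

Lemma core_sub f : core f -> N f.
Proof. by move=> /(_ id id VG_id); apply. Qed.

Lemma core_comp f g : core f -> core g -> core (f \o g).
Proof.
move=> cf cg k k' Vk kk'; have := N_comp (cf k k' Vk kk') (cg k k' Vk kk').
congr N; apply: functional_extensionality => w /=.
by rewrite (proj2 kk').
Qed.

Lemma core_conj f k k' : V k -> inverses k k' -> core f -> core (k' \o f \o k).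
Proof.
move=> Vk kk' cf l l' Vl ll'.
exact: cf (VG_comp Vk Vl) (inverses_comp kk' ll').
Qed.

Lemma core_inv f : core f -> exists2 f', inverses f f' & core f'.
Proof.
move=> cf; have [f' ff' _] := VG_inv (commutator_VG (N_D (core_sub cf))).
exists f' => // k k' Vk kk'; apply: N_inv (cf k k' Vk kk') _.
exact: inverses_comp (inverses_comp (inverses_sym kk') ff') kk'.
Qed.

Definition commute_mod a b := exists2 m, core m & forall w, a (b w) = b (a (m w)).

Lemma commute_mod_sym a b : commute_mod a b -> commute_mod b a.
Proof.
move=> [m cm ab]; have [m' [mK mK'] cm'] := core_inv cm; exists m' => // w.
by rewrite ab mK'.
Qed.

Lemma commute_mod_comp a1 a2 b : V a2 ->
  commute_mod a1 b -> commute_mod a2 b -> commute_mod (a1 \o a2) b.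
Proof.
move=> Va2 [m1 cm1 a1b] [m2 cm2 a2b]; have [a2' aa' _] := VG_inv Va2.
(* Moving [m1] to the right past [a2] conjugates it by an element of V_G, under which the core is
   invariant. *)
exists ((a2' \o m1 \o a2) \o m2); first by apply: core_comp => //; apply: core_conj.
by move=> w /=; rewrite a2b a1b (proj2 aa').
Qed.

Lemma commute_mod_conj a b s s' : V b -> inverses s s' ->
  commute_mod a s -> commute_mod (s' \o a \o s) b -> commute_mod a b.
Proof.
move=> Vb [sK sK'] [m cm as_] [m2 cm2 asb].
have [b' bb' _] := VG_inv Vb; have [m' mm' cm'] := core_inv cm.
(* Here [s' a s = a m]; evaluating the second relation at [b' (m' (b w))] cancels this [m] on the
   left. *)
exists (m \o m2 \o (b' \o m' \o b)).
  by apply: core_comp; [apply: core_comp | apply: core_conj].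
move=> w; have := asb (b' (m' (b w))).
by rewrite /= !as_ !sK (proj2 bb') (proj2 mm').
Qed.

Lemma commute_mod_commutator a a' b b' : inverses a a' -> inverses b b' ->
  core (a' \o b' \o a \o b) <-> commute_mod a b.
Proof.
move=> [aK aK'] [bK bK']; split=> [cm|[m cm ab]].
  by exists (a' \o b' \o a \o b) => // w /=; rewrite aK' bK'.
rewrite (_ : _ \o b = m) //; apply: functional_extensionality => w /=.
by rewrite ab bK aK.
Qed.

(** Conjugating by [k] replaces the common fixed cylinder [u] by some [z] that [k] maps into [u], so
    every conjugate of the commutator is again in N. *)
Lemma commute_mod_fixes u a b : V a -> V b -> fixes u a -> fixes u b ->
  commute_mod a b.
Proof.
move=> Va Vb au bu; have [a' aa' _] := VG_inv Va; have [b' bb' _] := VG_inv Vb.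
apply/(commute_mod_commutator aa' bb') => k k' Vk kk'.
have [z zu] := preimage_cyl u Vk.
have fix_conj c : fixes u c -> fixes z (k' \o c \o k).
  by move=> cu w /zu /cu /= ->; rewrite (proj1 kk').
have conj_inv c c' : inverses c c' -> inverses (k' \o c \o k) (k' \o c' \o k).
  move=> cc'.
  exact: inverses_comp (inverses_comp (inverses_sym kk') cc') kk'.
have := commutator_fixing_in_N (VG_conj Va Vk kk') (VG_conj Vb Vk kk')
  (conj_inv _ _ aa') (conj_inv _ _ bb') (fix_conj a au) (fix_conj b bu).
congr N; apply: functional_extensionality => w /=.
by rewrite !(proj2 kk').
Qed.

(** For comparable words the longer one is fixed by both. Otherwise the exchange [s] shares the
    fixed cylinder [u1 ++ u1] with [a], and [s a s] is trivial off [u1], hence on [u2]. *)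
Lemma commute_mod_fixes2 u1 u2 a b : V a -> V b -> fixes u1 a -> fixes u2 b ->
  commute_mod a b.
Proof.
move=> Va Vb au1 bu2.
have [/prefixP[r u2E]|n12] := boolP (prefix u1 u2).
  by apply: (@commute_mod_fixes u2) => //; rewrite u2E; apply: fixes_cat.
have [/prefixP[r u1E]|n21] := boolP (prefix u2 u1).
  by apply: (@commute_mod_fixes u1) => //; rewrite u1E; apply: fixes_cat.
pose s := cyl_flip u1 [::].
have ss : inverses s s := cyl_flip_inverses _ _.
have Vs : V s := VG_cyl_flip _ _.
apply: (commute_mod_conj Vb ss).
  apply: (@commute_mod_fixes (u1 ++ u1)) => //; first exact: fixes_cat.
  by rewrite -{1}[u1]cats0; apply: cyl_flip_fixes.
apply: (@commute_mod_fixes u2) => //; first exact: VG_conj.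
move=> w wu2; have nwu1 : ~~ in_cyl u1 w.
  apply/negP => /in_cyl_comparable/(_ wu2).
  by rewrite (negbTE n12) (negbTE n21).
rewrite /= /s (cyl_flip_out _ nwu1) au1 ?cyl_flip_icat //.
by rewrite cats0 in_cyl_icat.
Qed.

Lemma commutator_sub f : D f -> N f.
Proof.
elim=> // a a' b b' h Va Vb aK aK' bK bK' _ Nh; apply: N_comp => //.
apply: core_sub; apply/(commute_mod_commutator (conj aK aK') (conj bK bK')).
have [a1 [a2 [u1 [u2 [Va1 Va2 au1 au2 ->]]]]] := VG_factor Va.
have [b1 [b2 [v1 [v2 [Vb1 Vb2 bv1 bv2 ->]]]]] := VG_factor Vb.
apply: commute_mod_comp => //; apply: commute_mod_sym;
  apply: commute_mod_comp => //; apply: commute_mod_fixes2; eassumption.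
Qed.

End NormalSubgroup.
End Generation.

(** * Simplicity of V_G' *)

Theorem theorem4p6 (X : finType) (hX : 1 < #|X|)
  (G : (seq X -> seq X) -> Prop) (hG : self_similar_group G) :
  simple_group (commutator_subgroup (VG G)).
Proof.
have /card_gt1P[x [y [_ _ neq_xy]]] := hX.
split=> [|N nN]; first exact: commutator_nontrivial neq_xy hG.
have [ntN|trN] := classic (exists f, N f /\ f <> id).
  by right=> f; apply: (commutator_sub neq_xy hG nN ntN).
by left=> f Nf; apply: NNPP => f_nid; apply: trN; exists f.
Qed.
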